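(* Let $G=(A\cup B,E)$ be a bipartite graph that is $r$-regular and $K_{2,s}$-free for some $s\ge2$. Then $\widehat{S}(\mathrm{GAL}_G)\ge 2^{\lfloor (r-1)/(s-1)\rfloor}$.
   Context: $r$-regular: every vertex has degree $r$. $K_{2,s}$-free: $G$ contains no subgraph isomorphic to $K_{2,s}$, i.e. no two distinct vertices have $s$ common neighbours. For $S\subseteq A$, $\mathrm{N}(S)\subseteq B$ is the set of neighbours of $S$. $\mathrm{GAL}_G:\{0,1\}^A\to\{0,1\}$ treats $x$ as a subset of $A$ and is $1$ iff $\mathrm{N}(x)=B$. For $f:\{0,1\}^n\to\{0,1\}$ and $D\subseteq[n]$, $f_D$ is the matrix with rows indexed by $\alpha\in\{0,1\}^D$, columns by assignments to the complement, entry the value of $f$; $\mathsf{mult}(f_D)$ is the number of occurrences of a most frequent row; $\widehat{S}(f)=\max_{1\le k\le n}\min_{|D|=k}2^k/\mathsf{mult}(f_D)$. *)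

(* Defs.v *)
From mathcomp Require Import all_boot all_order all_algebra.

Set Implicit Arguments.
Unset Strict Implicit.
Unset Printing Implicit Defensive.

Import Order.TTheory GRing.Theory Num.Theory.
Local Open Scope ring_scope.

Definition neighbours (V : finType) (e : rel V) (v : V) : {set V} :=
  [set u | e v u].

Definition regular (V : finType) (e : rel V) (r : nat) : Prop :=
  forall v : V, #|neighbours e v| = r.

(* Subgraphs need not be induced: only edges of H have to be preserved. *)
Definition contains_subgraph (W V : finType) (h : rel W) (e : rel V) : Prop :=
  exists phi : W -> V, injective phi /\ forall x y, h x y -> e (phi x) (phi y).

(* A bipartite graph with parts A and B is given by E : A -> B -> bool; as a
   simple graph it lives on the disjoint union A + B. *)
Definition bip_graph (A B : finType) (E : A -> B -> bool) : rel (A + B) :=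
  fun u v => match u, v with
             | inl a, inr b => E a b
             | inr b, inl a => E a b
             | _, _ => false
             end.

Definition complete_bip (s t : nat) : rel ('I_s + 'I_t) :=
  bip_graph (fun _ _ => true).

Definition K2free (V : finType) (s : nat) (e : rel V) : Prop :=
  ~ contains_subgraph (@complete_bip 2 s) e.

Lemma K2freeP (V : finType) (s : nat) (e : rel V) :
  symmetric e -> irreflexive e ->
  K2free s e <->
  forall u v, u != v -> (#|neighbours e u :&: neighbours e v| < s)%N.
Proof.
move=> e_sym e_irr; split=> [noK u v uv|few [phi [phiI phiE]]].
  rewrite ltnNge; apply/negP => le_s; apply: noK.
  set C := _ :&: _ in le_s.
  have Cadj (c : 'I_#|C|) : e u (enum_val c) && e v (enum_val c).
    by have := enum_valP c; rewrite !inE.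
  pose c (j : 'I_s) := enum_val (widen_ord le_s j).
  have cu j : e u (c j) by case/andP: (Cadj (widen_ord le_s j)).
  have cv j : e v (c j) by case/andP: (Cadj (widen_ord le_s j)).
  have end_c (i : 'I_2) j : e (if i == ord0 then u else v) (c j).
    by case: ifP.
  exists (fun x => match x with
                   | inl i => if i == ord0 then u else v
                   | inr j => c j end); split.
    have end_neq (i : 'I_2) j : (if i == ord0 then u else v) <> c j.
      by move=> E; have := end_c i j; rewrite E e_irr.
    move=> [i|j] [i'|j'] /=.
    - case: i => [[|[|//]] ?]; case: i' => [[|[|//]] ?] //= E;
        try by congr inl; apply: val_inj.
      + by rewrite E eqxx in uv.
      + by rewrite E eqxx in uv.
    - by move/end_neq.
    - by move/esym/end_neq.
    - by move/enum_val_inj => [] /val_inj ->.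
  by move=> [i|j] [i'|j'] //= _; rewrite 1?[e (c _) _]e_sym; apply: end_c.
have uv : phi (inl ord0) != phi (inl ord_max).
  by apply/eqP => /phiI.
have := few _ _ uv; rewrite ltnNge => /negP; apply.
rewrite -[X in (X <= _)%N](card_ord s) -(card_imset 'I_s (f := phi \o inr)).
  by apply/subset_leq_card/subsetP => _ /imsetP[j _ ->]; rewrite !inE !phiE.
by move=> j j' /phiI [].
Qed.

Definition cube (I : finType) := {ffun I -> bool}.

Section Multiplicity.
Variables (I : finType) (f : cube I -> bool).

Definition inside (D : {set I}) : finType := {i : I | i \in D}.
Definition outside (D : {set I}) : finType := {i : I | i \notin D}.

Definition glue (D : {set I}) (x : cube (inside D)) (y : cube (outside D)) :
    cube I :=
  [ffun i => match boolP (i \in D) with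
             | AltTrue iD => x (exist _ i iD)
             | AltFalse iND => y (exist _ i iND)
             end].

Definition row_of (D : {set I}) (x : cube (inside D)) :
    {ffun cube (outside D) -> bool} :=
  [ffun y => f (glue x y)].

Definition mult (D : {set I}) : nat :=
  \max_(w : {ffun cube (outside D) -> bool}) #|[set x | row_of x == w]|.

Lemma mult_gt0 (D : {set I}) : (0 < mult D)%N.
Proof.
pose x : cube (inside D) := [ffun=> false].
apply: leq_trans (leq_bigmax (row_of x)).
by rewrite card_gt0; apply/set0Pn; exists x; rewrite inE.
Qed.

(* The initial values 2 ^+ k and 0 of the iterated min and max are neutral:
   0 < 2 ^+ k / mult D <= 2 ^+ k by mult_gt0, and for 1 <= k <= #|I| both
   ranges are nonempty as soon as I is. *)
Definition S_hat : rat :=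
  \big[Num.max/0]_(1 <= k < #|I|.+1)
    \big[Num.min/2 ^+ k]_(D : {set I} | #|D| == k) (2 ^+ k / (mult D)%:R).

End Multiplicity.

Section GAL.
Variables (A B : finType) (E : A -> B -> bool).

Definition Nset (S : {set A}) : {set B} := [set b | [exists a in S, E a b]].

Definition GAL (x : cube A) : bool := Nset [set a | x a] == [set: B].

End GAL.

(* Main.v *)
(** Let [t] be the floor of [(r - 1) / (s - 1)]; when [t > 0] take [k = t].  If
[D] has [t] elements then, two vertices having at most [s - 1] common
neighbours, every [a] in [D] has a neighbour [b] adjacent to no other element
of [D].  Complete [x] by all the vertices outside [D] that are not adjacent to
[b]: every vertex other than [b] is then covered, since it has at least
[r - s + 1 > t - 1] neighbours that are not adjacent to [b], whereas [b] is
covered exactly when [x] contains [a].  Hence the row of [x] determines [x], and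
all the rows of [GAL_D] are distinct. *)
Require Import Defs.
From mathcomp Require Import all_boot all_order all_algebra.
From mathcomp Require Import zify.

Set Implicit Arguments.
Unset Strict Implicit.
Unset Printing Implicit Defensive.

Import Order.TTheory GRing.Theory Num.Theory.
Local Open Scope ring_scope.

Section Multiplicity.
Variables (I : finType) (f : cube I -> bool).
Implicit Type D : {set I}.

Lemma glueE_in D (x : cube (inside D)) y (i : inside D) :
  glue x y (val i) = x i.
Proof.
rewrite ffunE; case: {-}_ / boolP => [iD|iD]; last by case: (negP iD (valP i)).
by congr (x _); apply: val_inj.
Qed.

Lemma glueE_out D (x : cube (inside D)) y (i : outside D) :
  glue x y (val i) = y i.
Proof.
rewrite ffunE; case: {-}_ / boolP => [iD|iD]; first by case: (negP (valP i) iD).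
by congr (y _); apply: val_inj.
Qed.

Lemma mult_le_exp D : (mult f D <= 2 ^ #|D|)%N.
Proof.
apply/bigmax_leqP => w _; apply: leq_trans (max_card _) _.
by rewrite card_ffun card_bool card_sig.
Qed.

Lemma mult_inj D : injective (@row_of I f D) -> mult f D = 1%N.
Proof.
move=> row_inj; apply/eqP; rewrite eqn_leq mult_gt0 andbT.
apply/bigmax_leqP => w _; apply/card_le1_eqP => x y.
by rewrite !inE => /eqP xw /eqP yw; apply: row_inj; rewrite xw yw.
Qed.

(** One [k] suffices, the outer operation being a maximum. The bound [c <= 2 ^+ k] accounts for the
    initial value of the iterated minimum. *)
Lemma le_S_hat k (c : rat) :
    (0 < k <= #|I|)%N -> c <= 2 ^+ k ->
    (forall D, #|D| = k -> c <= 2 ^+ k / (mult f D)%:R) ->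
  c <= S_hat f.
Proof.
move=> k_range c_le c_leD; rewrite /S_hat.
apply: (le_trans _ (le_bigmax_seq _ k _ _ _ _)) => //; last first.
  by rewrite mem_index_iota ltnS.
by apply/bigmin_geP; split=> // D /eqP; apply: c_leD.
Qed.

(** Take [k = 1]: among two rows none occurs more than twice. This settles the cases where the
    exponent is not positive. *)
Lemma S_hat_ge1 : (0 < #|I|)%N -> 1 <= S_hat f.
Proof.
move=> I_gt0; apply: (@le_S_hat 1) => [|//|D D1]; first by rewrite I_gt0.
rewrite ler_pdivlMr ?ltr0n ?mult_gt0 // mul1r expr1 ler_nat.
by have := mult_le_exp D; rewrite D1.
Qed.

End Multiplicity.

Section Bipartite.
Variables (A B : finType) (E : A -> B -> bool).

Lemma row_of_GAL_inj (D : {set A}) :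
    (forall a, a \in D -> exists b,
      [/\ E a b, forall a', a' \in D -> E a' b -> a' = a
        & forall b', b' != b -> exists a', [/\ a' \notin D, E a' b' & ~~ E a' b]]) ->
  injective (@row_of A (GAL E) D).
Proof.
move=> probe x x' /ffunP rows_eq; apply/ffunP => i.
have [b [ib b_priv cover]] := probe _ (valP i).
pose y : cube (outside D) := [ffun j => ~~ E (val j) b].
(* The column [y] depends on [i] alone, so comparing the two rows there gives [x i = x' i]. *)
suff GALy z : GAL E (glue z y) = z i.
  by have := rows_eq y; rewrite !ffunE !GALy.
(* Vertices supplied by [y] are not adjacent to [b], so whatever covers [b] lies in [D] and must be
   [i]. *)
apply/eqP/idP => [/setP/(_ b) | zi].
  rewrite !inE => /existsP[a]; rewrite inE => /andP[za ab].
  have [aD|aND] := boolP (a \in D).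
    have ->: i = Sub a aD by apply: val_inj; rewrite /= (b_priv a).
    by move: za; rewrite -(glueE_in z y).
  by move: za; rewrite (glueE_out z y (Sub a aND)) ffunE /= ab.
apply/setP => b'; rewrite !inE; apply/existsP.
have [->|/cover[a [aND ab' aNb]]] := eqVneq b' b.
  by exists (val i); rewrite inE glueE_in zi.
by exists a; rewrite inE (glueE_out z y (Sub a aND)) ffunE /= aNb.
Qed.

Lemma bip_graph_sym : symmetric (bip_graph E).
Proof. by case=> [a|b] [a'|b']. Qed.

Lemma bip_graph_irr : irreflexive (bip_graph E).
Proof. by case. Qed.

Let NA (a : A) := [set b | E a b].
Let NB (b : B) := [set a | E a b].

Lemma neighbours_inl a : neighbours (bip_graph E) (inl a) = inr @: NA a.
Proof.
apply/setP => -[a'|b]; rewrite inE /=.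
  by apply/esym/imsetP => -[].
by rewrite mem_imset ?inE // => ? ? [].
Qed.

Lemma neighbours_inr b : neighbours (bip_graph E) (inr b) = inl @: NB b.
Proof.
apply/setP => -[a|b']; rewrite inE /=.
  by rewrite mem_imset ?inE // => ? ? [].
by apply/esym/imsetP => -[].
Qed.

Variables r s : nat.
Hypothesis E_regular : regular (bip_graph E) r.
Hypothesis E_K2free : K2free s (bip_graph E).

Lemma card_NA a : #|NA a| = r.
Proof.
by rewrite -(E_regular (inl a)) neighbours_inl card_imset // => ? ? [].
Qed.

Lemma card_NB b : #|NB b| = r.
Proof.
by rewrite -(E_regular (inr b)) neighbours_inr card_imset // => ? ? [].
Qed.

Lemma codegree_NA a a' : a != a' -> (#|NA a :&: NA a'| < s)%N.
Proof.
move=> aa'; have /(_ (inl a) (inl a') aa') :=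
  (K2freeP s bip_graph_sym bip_graph_irr).1 E_K2free.
rewrite !neighbours_inl -imsetI; last by move=> ? ? _ _ [].
by rewrite card_imset // => ? ? [].
Qed.

Lemma codegree_NB b b' : b != b' -> (#|NB b :&: NB b'| < s)%N.
Proof.
move=> bb'; have /(_ (inr b) (inr b') bb') :=
  (K2freeP s bip_graph_sym bip_graph_irr).1 E_K2free.
rewrite !neighbours_inr -imsetI; last by move=> ? ? _ _ [].
by rewrite card_imset // => ? ? [].
Qed.

(** Union bound: each other element of [D] shares at most [s.-1] neighbours with [a], so fewer than
    [r] of the neighbours of [a] are shared. *)
Lemma private_neighbour (D : {set A}) a :
    (#|D :\ a| * s.-1 < r)%N ->
  exists2 b, E a b & forall a', a' \in D -> E a' b -> a' = a.
Proof.
move=> D_small.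
pose U := \bigcup_(a' in D :\ a) (NA a :&: NA a').
have U_small : (#|U| < r)%N.
  apply: leq_ltn_trans D_small; rewrite -sum_nat_const.
  apply: (big_ind2 (fun (S : {set B}) m => #|S| <= m)%N) => [|S m S' m' Sm S'm'|a'].
  - by rewrite cards0.
  - by apply: leq_trans (leq_card_setU _ _) (leq_add Sm S'm').
  rewrite !inE eq_sym => /andP[/codegree_NA].
  by case: (s).
have /subsetPn[b] : ~~ (NA a \subset U).
  by apply: contraL U_small => /subset_leq_card; rewrite card_NA -leqNgt.
rewrite inE => ab bNU; exists b => // a' a'D a'b.
apply: contraNeq bNU => a'a; apply/bigcupP; exists a'; first by rewrite !inE a'a.
by rewrite !inE ab.
Qed.

(** At least [r - s + 1] neighbours of [b'] lie outside [NB b], while [D] has at most [r - s]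
    elements there. *)
Lemma uncovered_neighbour (D : {set A}) b b' :
    (#|D :\: NB b| + s <= r)%N -> b' != b ->
  exists a, [/\ a \notin D, E a b' & ~~ E a b].
Proof.
move=> D_small /codegree_NB few.
have /subsetPn[a] : ~~ (NB b' :\: NB b \subset D :\: NB b).
  apply/negP => /subset_leq_card.
  by have := cardsID (NB b) (NB b'); rewrite card_NB; lia.
by rewrite !inE => /andP[aNb ab']; rewrite aNb => aND; exists a.
Qed.

Lemma row_of_GAL_inj_regular (D : {set A}) :
  (#|D| * s.-1 < r)%N -> (1 < s)%N -> injective (@row_of A (GAL E) D).
Proof.
move=> D_small s_gt1; apply: row_of_GAL_inj => a aD.
have Da := cardsD1 a D; rewrite aD in Da.
have [|b ab b_priv] := @private_neighbour D a; first by nia.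
exists b; split=> // b'; apply: uncovered_neighbour.
(* Since [a] is in [D] and adjacent to [b], at most [d - 1] elements remain, where [d = #|D|]. Then
   [(d - 1)(s - 2) >= 0] yields [d - 1 + s <= d (s - 1) + 1 <= r]. *)
suff /subset_leq_card : D :\: NB b \subset D :\ a by nia.
by apply: setDS; rewrite sub1set inE.
Qed.

End Bipartite.

Theorem theorem6p4 (A B : finType) (E : A -> B -> bool) (r s : nat)
  (A_gt0 : (0 < #|A|)%N)
  (s_ge2 : (2 <= s)%N)
  (E_regular : regular (bip_graph E) r)
  (E_K2free : K2free s (bip_graph E)) :
  (2 : rat) ^ Num.floor ((r%:R - 1) / (s%:R - 1) : rat) <= S_hat (GAL E).
Proof.
set q : rat := _ / _.
have s1_gt0 : 0 < s%:R - 1 :> rat by rewrite subr_gt0 ltr1n.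
have floorq : (Num.floor q)%:~R * (s%:R - 1) <= r%:R - 1 :> rat.
  by rewrite -ler_pdivlMr // Num.Theory.floor_le.
case: (Num.floor q) floorq => [[|k]|k] floorq; first exact: S_hat_ge1.
  have {floorq} k_small : (k.+1 * s.-1 < r)%N.
    have -> : (k.+1 * s.-1 < r)%N = (k.+1%:R * s.-1%:R + 1 <= r%:R :> rat).
      by rewrite -natrM natr1 ler_nat.
    by rewrite -lerBrDr -subn1 natrB 1?ltnW.
  (* The size [k.+1] must be admissible: as [r > 0], some [b] exists, and its [r] neighbours lie in
     [A], so [k.+1 <= r <= #|A|]. *)
  have k_le : (k < #|A|)%N.
    have /card_gt0P[a _] := A_gt0.
    have /card_gt0P[b _] : (0 < #|[set b | E a b]|)%N.
      by rewrite (card_NA E_regular) (leq_ltn_trans _ k_small).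
    by have := max_card [set a | E a b]; rewrite (card_NB E_regular); nia.
  apply: (@le_S_hat _ _ k.+1) => // D Dk.
  by rewrite mult_inj ?divr1 //; apply: (@row_of_GAL_inj_regular _ _ _ r s); rewrite ?Dk.
(* A negative floor occurs only for [r = 0]; the power of 2 is then at most 1. *)
apply: le_trans (S_hat_ge1 _ A_gt0).
by rewrite NegzE -exprnN invf_le1 ?exprn_ege1 ?exprn_gt0.
Qed.
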